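(* Let $X$ be a group with identity $e$, $G\subset X$ a subgroup and $M\subset X$ a transversal with $e\in M$ (for every $x\in X$ there is a unique $s\in M$ with $x\in Gs$), with associated maps $\cdot,\tau,\triangleright,\triangleleft$ defined by $st=\tau(s,t)(s\cdot t)$ and $su=(s\triangleright u)(s\triangleleft u)$ for $s,t\in M$, $u\in G$. Then $(M,\cdot)$ is a (two-sided inverse property) quasigroup if and only if $$t=t\triangleleft\tau(s^{-L},s)\qquad\text{and}\qquad s^{-L}=s^{-L}\triangleleft\tau(s,t)$$ for all $s,t\in M$. In this case $(s^{-L})^{-L}=s$ for all $s\in M$, i.e. $s^{-L}=s^{-R}$ is also the right inverse of $s$ in $(M,\cdot)$.
   Context: Setting: since every element of $X$ can be written uniquely as $us$ with $u\in G$, $s\in M$, the formulas $st=\tau(s,t)(s\cdot t)$ and $su=(s\triangleright u)(s\triangleleft u)$ (products on the left taken in $X$) uniquely define maps $\tau:M\times M\to G$, $\cdot:M\times M\to M$, $\triangleright:M\times G\to G$, $\triangleleft:M\times G\to M$. For $s\in M$, $s^{-L}$ denotes the unique element of $M$ with $s^{-1}\in Gs^{-L}$, where $s^{-1}$ is the inverse in $X$ (equivalently $s^{-1}=\tau(s^{-L},s)^{-1}s^{-L}$); it is the unique left inverse of $s$ in $(M,\cdot)$, i.e. $s^{-L}\cdot s=e$. A right inverse $s^{-R}\in M$ of $s$ is an element with $s\cdot s^{-R}=e$. (Two-sided inverse property) quasigroup (= IP loop): a set $M$ with a product, a two-sided identity $e$, and for each $s\in M$ an element $s^{-1}\in M$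 (inverse in $M$) such that $s^{-1}(st)=t$ and $(ts)s^{-1}=t$ for all $t\in M$. *)

(* Defs.v *)
From HB Require Import structures.
From mathcomp Require Import all_boot.
From mathcomp Require Import boolp classical_sets.

Set Implicit Arguments.
Unset Strict Implicit.
Unset Printing Implicit Defensive.

Local Open Scope group_scope.

(* [groupType] is the type of arbitrary, possibly infinite, groups. *)

Definition is_subgroup (X : groupType) (G : set X) : Prop :=
  group_closed (mem G).

(* [x \in G s], where [G s] is the right coset of [s]. *)
Definition in_rcoset (X : groupType) (G : set X) (s x : X) : Prop :=
  exists2 u : X, G u & x = u * s.

Definition is_coset_transversal (X : groupType) (G M : set X) : Prop :=
  M 1 /\ forall x : X, exists! s : X, M s /\ in_rcoset G s x.

Section Factorization.
Variables (X : groupType) (G M : set X) (MT : is_coset_transversal G M).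

Lemma factor_ex (x : X) : exists p : G * M, x = val p.1 * val p.2.
Proof.
have [s [[Ms [u Gu xE]] _]] := MT.2 x.
by exists (exist _ u (mem_set Gu), exist _ s (mem_set Ms)).
Qed.

Definition factor (x : X) : G * M := projT1 (cid (factor_ex x)).

Lemma factorE (x : X) : x = val (factor x).1 * val (factor x).2.
Proof. by rewrite /factor; case: cid. Qed.

Lemma factor_unique (u : G) (s : M) : factor (val u * val s) = (u, s).
Proof.
set x := val u * val s.
have [s0 [_ s0_uniq]] := MT.2 x.
have sE : val (factor x).2 = val s.
  rewrite -(s0_uniq (val s)); last first.
    by split; [exact: set_valP | exists (val u) => //; exact: set_valP].
  apply/esym/s0_uniq; split; first exact: set_valP.
  by exists (val (factor x).1); [exact: set_valP | exact: factorE].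
have uE : val (factor x).1 = val u.
  by apply: (@mulIg X (val s)); rewrite -{1}sE -factorE.
by rewrite [LHS]surjective_pairing; congr (_, _); apply: val_inj.
Qed.

Definition M1 : M := exist _ 1 (mem_set MT.1).

(* [s t = tau(s,t) (s . t)] and [s u = (s |> u) (s <| u)] in [X]. *)
Definition tau (s t : M) : G := (factor (val s * val t)).1.
Definition dot (s t : M) : M := (factor (val s * val t)).2.
Definition tri_right (s : M) (u : G) : G := (factor (val s * val u)).1.
Definition tri_left (s : M) (u : G) : M := (factor (val s * val u)).2.

(* [s^{-L}]: the element of [M] with [s^-1 \in G s^{-L}]. *)
Definition linv (s : M) : M := (factor (val s)^-1).2.

End Factorization.

(* Inverse property quasigroup (= IP loop). *)
Definition is_ip_quasigroup (M : Type) (op : M -> M -> M) : Prop :=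
  exists e : M, [/\ left_id e op, right_id e op &
    forall s : M, exists s' : M, forall t : M,
      op s' (op s t) = t /\ op (op t s) s' = t].

(* Main.v *)
(** Write [x]_M for the representative in [M] of the coset [G x]. Since
[G \ X] is a right [X]-set, [[x]_M y]_M = [x y]_M; hence
[s . t = [s t]_M], [s <| u = [s u]_M], and
[(s <| tau(t,r)) . (t . r) = (s . t) . r]. The two conditions are thus
instances of the inverse properties [(t . s^{-L}) . s = t] and
[s^{-L} . (s . t) = t]: the first one because
[tau(s^{-L}, s) = s^{-L} s], the second one by cancelling [s . t]. *)

Require Import Defs.
From mathcomp Require Import all_boot.
From mathcomp Require Import boolp classical_sets.

Section TransversalProduct.
Set Implicit Arguments.
Unset Strict Implicit.
Local Open Scope group_scope.
Context (X : groupType) (G M : set X).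
Hypotheses (GX : is_subgroup G) (MT : is_coset_transversal G M).

Local Notation rep x := (factor MT x).2.
Local Notation "s ** t" := (dot MT s t) (at level 40, left associativity).
Local Notation L := (linv MT).

Lemma rep_mulg_subgroup (u : G) (x : X) : rep (val u * x) = rep x.
Proof.
have uvG : val u * val (factor MT x).1 \in G.
  by apply: (group_closedM GX); exact: valP.
by rewrite [in LHS](factorE MT x) mulgA (factor_unique MT (exist (in_mem^~ (mem G)) _ uvG)).
Qed.

Lemma rep_repl (x y : X) : rep (val (rep x) * y) = rep (x * y).
Proof. by rewrite [in RHS](factorE MT x) -mulgA rep_mulg_subgroup. Qed.

Lemma rep_val (s : M) : rep (val s) = s.
Proof.
have G1 : 1 \in G by exact: GX.1.
by rewrite -[val s]mul1g (factor_unique MT (exist (in_mem^~ (mem G)) _ G1)).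
Qed.

Lemma dot1s (s : M) : M1 MT ** s = s.
Proof. by rewrite /dot mul1g rep_val. Qed.

Lemma dots1 (s : M) : s ** M1 MT = s.
Proof. by rewrite /dot mulg1 rep_val. Qed.

Lemma linv_dot (s : M) : L s ** s = M1 MT.
Proof. by rewrite /dot /linv rep_repl mulVg -(rep_val (M1 MT)). Qed.

(** If [r s] lies in [G], then [s^-1 = (r s)^-1 r] lies in [G r]. *)
Lemma linv_unique (r s : M) : r ** s = M1 MT -> L s = r.
Proof.
move=> rs1; have := rep_repl (val r * val s) (val s)^-1.
by rewrite -/(dot MT r s) rs1 mul1g mulgK rep_val.
Qed.

Lemma dot_tri_left (s t r : M) :
  tri_left MT s (tau MT t r) ** (t ** r) = s ** t ** r.
Proof.
rewrite /dot /tri_left /tau rep_repl -mulgA -(factorE MT (val t * val r)).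
by rewrite rep_repl mulgA.
Qed.

Lemma tri_left_tau_linv (s t : M) :
  tri_left MT t (tau MT (L s) s) = t ** L s ** s.
Proof. by rewrite -dot_tri_left linv_dot dots1. Qed.

(** Makes the existential inverses explicit: at [t = 1] the law [s' . (s . t) = t] makes [s'] a left
    inverse of [s], so [s' = L s] by uniqueness. *)
Lemma ip_quasigroupP :
  is_ip_quasigroup (dot MT) <->
  forall s t : M, L s ** (s ** t) = t /\ t ** s ** L s = t.
Proof.
split=> [[e [_ sE ip]] s t|ip]; last first.
  by exists (M1 MT); split=> [||s]; [exact: dot1s|exact: dots1|exists (L s)].
have [s' ips'] := ip s.
have /linv_unique -> : s' ** s = M1 MT by have [] := ips' (M1 MT); rewrite dots1.
exact: ips'.
Qed.

Lemma linvK : (forall s t : M, L s ** (s ** t) = t) -> involutive L.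
Proof. by move=> lK s; have := lK (L s) s; rewrite linv_dot dots1. Qed.

End TransversalProduct.

Theorem proposition3p6 (X : groupType) (G M : set X)
    (GX : is_subgroup G) (MT : is_coset_transversal G M) :
  (is_ip_quasigroup (dot MT) <->
     forall s t : M,
       t = tri_left MT t (tau MT (linv MT s) s) /\
       linv MT s = tri_left MT (linv MT s) (tau MT s t))
  /\
  (is_ip_quasigroup (dot MT) ->
     forall s : M,
       linv MT (linv MT s) = s /\
       (forall r : M, dot MT s r = M1 MT <-> r = linv MT s)).
Proof.
split; last first.
  move=> /(ip_quasigroupP GX) ip s.
  split=> [|r]; first by apply: linvK => // ? ?; apply: (ip _ _).1.
  split=> [sr1|->]; first by have [] := ip s r; rewrite sr1 dots1.
  by have [_] := ip s (M1 MT); rewrite dot1s.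
rewrite (ip_quasigroupP GX); split=> ip s t.
  have linvV : involutive (linv MT) by apply: linvK => // ? ?; apply: (ip _ _).1.
  split.
    by rewrite tri_left_tau_linv //; have [_] := ip (linv MT s) t; rewrite linvV.
  (* Right multiplication by [s . t] is undone by its inverse. It sends both sides of the second
     condition to [t], the right side via [(L s . s) . t]. *)
  have dotI : injective ((dot MT)^~ (dot MT s t)).
    by apply: (can_inj (g := (dot MT)^~ (linv MT (dot MT s t)))) => r; apply: (ip _ _).2.
  by apply: dotI; rewrite /= dot_tri_left // linv_dot // dot1s //; apply: (ip _ _).1.
(* The second condition turns [L a . (a . b)] into [(L a . a) . b]. *)
have lK a b : dot MT (linv MT a) (dot MT a b) = b.
  by rewrite {1}(ip a b).2 dot_tri_left // linv_dot // dot1s.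
split=> //.
(* With [s = L (L s)], this is the first condition taken at [L s]. *)
by rewrite -{1}(linvK GX lK s) -tri_left_tau_linv // -(ip _ _).1.
Qed.
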